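(* Let $d\ge1$, $I=[0,1)^d$, and let $S\subset\mathbb{R}^d$ be a non-empty set such that the cubes $I+s$, $s\in S$, are pairwise disjoint. Then there is a decomposition of $S$ into two disjoint sets $S^0,S^1$ with $S=S^0\cup S^1$ (one of which may be empty) such that for each $j\in\{0,1\}$ the set $F^j=\bigcup_{s\in S^j}(I+s)$ is rough, i.e. for every $u\in\mathbb{R}^d$, if $I+u\subseteq F^j$ then $u\in S^j$. *)

(* Defs.v *)
From mathcomp Require Import all_boot all_order all_algebra.
From mathcomp Require Import classical_sets reals.

Set Implicit Arguments.
Unset Strict Implicit.
Unset Printing Implicit Defensive.

Import Order.TTheory GRing.Theory Num.Theory.

Local Open Scope classical_set_scope.
Local Open Scope ring_scope.

Definition unit_cube (R : realType) (d : nat) : set 'rV[R]_d :=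
  [set x | forall i : 'I_d, 0 <= x ord0 i < 1].

Arguments unit_cube R d : clear implicits.

Definition cube (R : realType) (d : nat) (s : 'rV[R]_d) : set 'rV[R]_d :=
  [set x + s | x in unit_cube R d].

Definition cube_union (R : realType) (d : nat) (T : set 'rV[R]_d) :
    set 'rV[R]_d :=
  \bigcup_(s in T) cube s.

(* Roughness is a property of the union F of the cubes I + s, s in T, but it
   refers to the translation set T, so the predicate takes T; it is used only
   when these cubes are pairwise disjoint. *)
Definition rough (R : realType) (d : nat) (T : set 'rV[R]_d) : Prop :=
  forall u : 'rV[R]_d, cube u `<=` cube_union T -> T u.

(* Main.v *)
(** Colour s by the parity of the sum of the floors of its coordinates.  Suppose
    I + u is covered by cubes of one colour, none of them I + u.  Among those
    meeting I + u take I + s differing from u in a maximal set J of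
    coordinates, and for i in J let c_i be the point of ]u_i, u_i + 1[
    congruent to s_i mod 1 and p_i < c_i close to c_i.  Sum (-1)^#|A| over all
    A included in J, where A encodes the point of I + u with coordinates p_i for
    i in A, c_i for i in J \ A, and u_i elsewhere.  The total is 0.  If the cube
    covering the point of A contains both p_i and c_i in some direction i of J,
    then A cancels with its flip at i.  Otherwise that cube is
    congruent to s mod 1 by maximality of J, and lies on the left of u exactly in
    the directions of A; its colour then forces (-1)^#|A| to be always the same.
    As the cube I + s itself is of the latter kind, the total is nonzero. *)
Require Import Defs.
From mathcomp Require Import all_boot all_order all_algebra.
From mathcomp Require Import classical_sets reals.
From mathcomp Require Import boolp lra.

Set Implicit Arguments.
Unset Strict Implicit.
Unset Printing Implicit Defensive.

Import Order.TTheory GRing.Theory Num.Theory.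

Local Open Scope classical_set_scope.
Local Open Scope ring_scope.

Definition flip (I : finType) (i : I) (A : {set I}) : {set I} :=
  [set j | (j \in A) (+) (j == i)].

Lemma flipK (I : finType) (i : I) : involutive (flip i).
Proof. by move=> A; apply/setP=> j; rewrite !inE -addbA addbb addbF. Qed.

Lemma odd_sum (I : finType) (f : I -> nat) :
  odd (\sum_i f i) = \big[addb/false]_i odd (f i).
Proof. exact: (big_morph odd oddD (erefl _)). Qed.

Lemma odd_card (I : finType) (A : {set I}) :
  odd #|A| = \big[addb/false]_i (i \in A).
Proof.
rewrite -sum1_card big_mkcond odd_sum.
by apply: eq_bigr => i _; case: (i \in A).
Qed.

Lemma odd_card_flip (I : finType) (i : I) (A : {set I}) :
  odd #|flip i A| = ~~ odd #|A|.
Proof.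
rewrite !odd_card.
under eq_bigr => j _ do rewrite inE.
rewrite big_split /= -addbT; congr (_ (+) _).
rewrite (bigD1 i) //= eqxx big1 // => j /negPf.
by [].
Qed.

Lemma flip_subset (I : finType) (i : I) (A J : {set I}) :
  i \in J -> A \subset J -> flip i A \subset J.
Proof.
move=> iJ /fintype.subsetP AJ; apply/fintype.subsetP => j; rewrite inE.
by have [->//|_] := eqVneq j i; rewrite addbF => /AJ.
Qed.

(** A sign-reversing involution: a flip changes the parity of [#|A|], and since [k] is unchanged by
    its own flip, flipping twice returns to [A]. *)
Lemma signed_sum_flip (I : finType) (P : pred {set I}) (k : {set I} -> I) :
  (forall A, P A -> P (flip (k A) A) /\ k (flip (k A) A) = k A) ->
  \sum_(A | P A) (-1) ^+ #|A| = 0 :> int.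
Proof.
move=> Pk; set h := fun A => flip (k A) A.
have hK A : P A -> h (h A) = A.
  by case/Pk => _ kA; rewrite /h kA flipK.
suff : \sum_(A | P A) (-1) ^+ #|A| = - \sum_(A | P A) (-1) ^+ #|A| :> int.
  by move/eqP; rewrite eq_sym eqNr => /eqP.
rewrite {1}(reindex_onto h h) // -sumrN; apply: eq_big => [A|A _].
  apply/andP/idP => [[PhA /eqP <-]|PA]; first by case: (Pk _ PhA).
  by rewrite hK // eqxx; case: (Pk _ PA).
rewrite -[in LHS]signr_odd -[in RHS]signr_odd [in LHS]/h.
by rewrite odd_card_flip signrN.
Qed.

Lemma cubeE (R : realType) (d : nat) (s x : 'rV[R]_d) :
  cube s x <-> forall i, s ord0 i <= x ord0 i < s ord0 i + 1.
Proof.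
split=> [[y yI <-] i|sx]; first by have := yI i; rewrite !mxE; lra.
exists (x - s); last by rewrite subrK.
by move=> i; have := sx i; rewrite !mxE; lra.
Qed.

Lemma cube_unique (R : realType) (d : nat) (T : set 'rV[R]_d)
    (s t x : 'rV[R]_d) :
  trivIset T (@cube R d) -> T s -> T t -> cube s x -> cube t x -> s = t.
Proof. by move=> disjT Ts Tt sx tx; apply: disjT => //; exists x. Qed.

Definition overlaps (R : realType) (d : nat) (u t : 'rV[R]_d) :=
  forall i, u ord0 i - 1 < t ord0 i < u ord0 i + 1.

Definition left_of (R : realType) (d : nat) (u t : 'rV[R]_d) : {set 'I_d} :=
  [set i | t ord0 i < u ord0 i].

(* The coordinate, in [u_i, u_i + 1[, of the face of I + t cutting I + u in
   direction i; it is u_i when t_i = u_i. *)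
Definition cut (R : realType) (d : nat) (u t : 'rV[R]_d) (i : 'I_d) : R :=
  if t ord0 i < u ord0 i then t ord0 i + 1 else t ord0 i.

Definition offset (R : realType) (d : nat) (u t : 'rV[R]_d) : {set 'I_d} :=
  [set i | t ord0 i != u ord0 i].

(** The absolute value only moves the floors to [nat]; it preserves their parity. *)
Definition parity (R : realType) (d : nat) (t : 'rV[R]_d) : bool :=
  odd (\sum_i `|Num.floor (t ord0 i)|).

Lemma cube_overlaps (R : realType) (d : nat) (u t x : 'rV[R]_d) :
  cube u x -> cube t x -> overlaps u t.
Proof.
by move=> /cubeE ux /cubeE tx i; have := ux i; have := tx i; lra.
Qed.

Lemma overlaps_left_inj (R : realType) (d : nat) (T : set 'rV[R]_d)
    (u s t : 'rV[R]_d) :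
  trivIset T (@cube R d) -> T s -> T t -> overlaps u s -> overlaps u t ->
  left_of u s = left_of u t -> s = t.
Proof.
move=> disjT Ts Tt us ut /setP eq_left.
(* Both cubes contain the coordinatewise maximum of s and t. *)
apply: (@cube_unique _ _ _ _ _ (\row_i Num.max (s ord0 i) (t ord0 i)) disjT);
  rewrite // cubeE => i; have := eq_left i; have := us i; have := ut i;
  rewrite !inE !mxE; case: (ltP (s _ i) (u _ i)) => su;
  case: (ltP (t _ i) (u _ i)) => tu // ? ? _;
  by case: (ltP (s _ i) (t _ i)) => st; lra.
Qed.

(** Indexing the overlapping cubes by subsets of ['I_d] allows maxima over them to be taken on a
    finite type. *)
Lemma overlaps_finite (R : realType) (d : nat) (T : set 'rV[R]_d)
    (u : 'rV[R]_d) :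
  trivIset T (@cube R d) ->
  exists N : {set 'I_d} -> 'rV[R]_d,
    forall t, T t -> overlaps u t -> N (left_of u t) = t.
Proof.
move=> disjT.
exists (fun A => xget u [set t | [/\ T t, overlaps u t & left_of u t = A]]).
move=> t Tt ut; case: xgetP => [s _ [Ts us eq_left]|/(_ t)[]//].
exact: (overlaps_left_inj disjT).
Qed.

Lemma odd_floorD1 (R : realType) (x : R) :
  odd `|Num.floor (x + 1)| = ~~ odd `|Num.floor x|.
Proof.
rewrite floorDrz // floor1.
case: (Num.floor x) => n; first by rewrite addrC -intS.
have -> : Negz n + 1 = - n%:Z by rewrite NegzE intS opprD addrAC addNr add0r.
by rewrite NegzE !abszN /= negbK.
Qed.

(** Each left direction shifts a coordinate by 1, which toggles the parity of its floor. Hence two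
    cubes with the same cuts and the same colour have left sets of equal parity. *)
Lemma parity_cut (R : realType) (d : nat) (u t : 'rV[R]_d) :
  parity t =
    (\big[addb/false]_i odd `|Num.floor (cut u t i)|) (+) odd #|left_of u t|.
Proof.
rewrite /parity odd_sum odd_card -big_split; apply: eq_bigr => i _ /=.
by rewrite /cut inE; case: ifP; rewrite ?odd_floorD1 ?addbT ?negbK ?addbF.
Qed.

(* A cube containing one of p, c but not both must have its face at c, since p
   is chosen so that no face lies strictly between p and c. *)
Lemma cut_pinned (R : realType) (u t p c : R) (b : bool)
    (ct := if t < u then t + 1 else t) :
  u <= p < c -> c < u + 1 -> (ct < c -> ct <= p) ->
  t <= (if b then p else c) < t + 1 -> ~~ ((t <= p) && (c < t + 1)) ->
  ct = c /\ (t < u) = b.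
Proof.
rewrite /ct => upc cu gap tx /negP free.
have {}free : ~ (t <= p /\ c < t + 1) by move=> /andP.
case: (ltP t u) gap => tu gap.
- have tc : t + 1 = c.
    case: (ltgtP (t + 1) c) gap => // tc gap; last by case: free; lra.
    by have := gap isT; case: b tx; lra.
  by split=> //; case: b tx; lra.
- have tc : t = c.
    case: (ltgtP t c) gap => // tc gap; last by case: b tx; lra.
    by have := gap isT; case: free; lra.
  by split=> //; case: b tx; lra.
Qed.

Lemma monochromatic_rough (R : realType) (d : nat) (T : set 'rV[R]_d)
    (b : bool) :
  trivIset T (@cube R d) -> (forall t, T t -> parity t = b) -> rough T.
Proof.
move=> disjT parT u cov; apply: contrapT => Tu.
have [N NE] := overlaps_finite u disjT.
have uu : cube u u by rewrite cubeE => i; lra.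
pose card_offset n := `[< exists t, [/\ T t, overlaps u t & #|offset u t| = n] >].
have ex_n : exists n, card_offset n.
  have [t Tt ut] := cov _ uu.
  exists #|offset u t|; apply/asboolP; exists t; split=> //.
  exact: cube_overlaps ut.
have max_n n : card_offset n -> (n <= d)%N.
  by move/asboolP => [t [_ _ <-]]; rewrite -[leqRHS]card_ord max_card.
have [_ /asboolP[s [Ts us <-]] s_max] := ex_maxnP ex_n max_n.
pose J := offset u s; pose c := cut u s.
(* The last cut before [c i], or [u ord0 i] if there is none. Values of [N] at subsets that no cube
   realises are harmless: the filter keeps their cuts below [c i]. *)
pose p i := \big[Order.max/u ord0 i]_(B | cut u (N B) i < c i) cut u (N B) i.
have u_lt_c i : i \in J -> u ord0 i < c i.
  by rewrite inE /c /cut; have := us i; case: (ltgtP (s _ i) (u _ i)) => // ? ? _; lra.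
have c_lt i : c i < u ord0 i + 1.
  by rewrite /c /cut; have := us i; case: (ltP (s _ i) (u _ i)) => ? ?; lra.
have cJ i : i \notin J -> c i = u ord0 i.
  by rewrite inE negbK /c /cut => /eqP ->; rewrite ltxx.
have p_ge i : u ord0 i <= p i by exact: bigmax_ge_id.
have p_lt i : i \in J -> p i < c i by move=> iJ; apply/bigmax_ltP; split => //; exact: u_lt_c.
have gap t i : T t -> overlaps u t -> cut u t i < c i -> cut u t i <= p i.
  move=> Tt ut tc; rewrite -(NE _ Tt ut) in tc *.
  exact: (@le_bigmax_cond _ _ _ _ _ _ (fun B => cut u (N B) i)).
pose x (A : {set 'I_d}) : 'rV[R]_d := \row_i if i \in A then p i else c i.
have ux (A : {set 'I_d}) : A \subset J -> cube u (x A).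
  move=> /fintype.subsetP AJ; rewrite cubeE => i; rewrite mxE.
  have := c_lt i; have := p_ge i.
  case: ifP => [/AJ/p_lt|_]; first lra.
  by case: (boolP (i \in J)) => [/u_lt_c|/cJ->]; lra.
have [sel selE] : exists sel : 'rV[R]_d -> 'rV[R]_d,
    forall y, cube u y -> T (sel y) /\ cube (sel y) y.
  have /choice[sel selE] : forall y, exists t, cube u y -> T t /\ cube t y.
    move=> y; have [uy|] := pselect (cube u y); last by exists u.
    by have [t Tt ty] := cov _ uy; exists t.
  by exists sel.
pose free (t : 'rV[R]_d) i := [&& i \in J, t ord0 i <= p i & c i < t ord0 i + 1].
pose has_free (A : {set 'I_d}) := [exists i, free (sel (x A)) i].
(* If [J] were empty, [u] would equal [s] and so lie in [T]. The direction [j] serves to cancel the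
   full sum. *)
have [j jJ] : exists j, j \in J.
  apply/set0Pn/eqP => J0; apply: Tu; suff -> : u = s by [].
  apply/rowP => i; apply/esym/eqP; rewrite -[_ == _]negbK.
  by have /setP/(_ i) := J0; rewrite !inE => ->.
have total : \sum_(A : {set 'I_d} | A \subset J) (-1) ^+ #|A| = 0 :> int.
  apply: (signed_sum_flip (k := fun=> j)) => A AJ; split=> //.
  exact: flip_subset.
have freesum :
    \sum_(A : {set 'I_d} | (A \subset J) && has_free A) (-1) ^+ #|A| = 0 :> int.
  apply: (signed_sum_flip (k := fun A => odflt j [pick i | free (sel (x A)) i])).
  move=> A /andP[AJ /existsP[i0 freei0]].
  have [i freei pick_i] : exists2 i, free (sel (x A)) i &
      [pick i | free (sel (x A)) i] = Some i.
    by case: pickP => [i|/(_ i0)]; [exists i|rewrite freei0].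
  rewrite pick_i /=.
  have [iJ ti_le ti_gt] := and3P freei.
  have flipJ : flip i A \subset J by exact: flip_subset.
  (* A flip in a free direction stays inside the covering cube, so the free directions, and the one
     picked, do not change. *)
  have selx : sel (x (flip i A)) = sel (x A).
    have [Tt tx] := selE _ (ux _ AJ); have [Tt' tx'] := selE _ (ux _ flipJ).
    apply: (cube_unique disjT Tt' Tt tx'); move: tx; rewrite !cubeE => tx l.
    have := tx l; rewrite !mxE inE; have [->|_] := eqVneq l i; last by rewrite addbF.
    by have := p_lt _ iJ; case: (i \in A) => /=; lra.
  rewrite /has_free selx pick_i; split=> //.
  by rewrite flipJ; apply/existsP; exists i.
have pinned (A : {set 'I_d}) : A \subset J -> ~~ has_free A ->
    odd #|A| = odd #|left_of u s|.
  move=> AJ /existsPn nfree.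
  have [] := selE _ (ux _ AJ); set t := sel (x A) in nfree * => Tt tx.
  have ut := cube_overlaps (ux _ AJ) tx.
  have tJ i : i \in J -> cut u t i = c i /\ (t ord0 i < u ord0 i) = (i \in A).
    move=> iJ; apply: (@cut_pinned _ _ _ (p i)) => //.
    - by rewrite p_ge p_lt.
    - exact: gap.
    - by move/cubeE: tx => /(_ i); rewrite mxE.
    - by have := nfree i; rewrite /free iJ.
  (* Having cut [c i] inside ]u_i, u_i + 1[ forces [t] off [u] in every direction of [J]; maximality
     of [#|J|] excludes any further direction. *)
  have offJ : offset u t = J.
    apply/esym/eqP; rewrite eqEcard; apply/andP; split.
      apply/fintype.subsetP => i iJ; have [tc _] := tJ _ iJ; have := u_lt_c _ iJ.
      by rewrite -tc /cut inE; apply: contraTneq => ->; rewrite !ltxx.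
    by apply: s_max; apply/asboolP; exists t.
  have tNJ i : i \notin J -> t ord0 i = u ord0 i.
    by rewrite -offJ inE negbK => /eqP.
  have left_t : left_of u t = A.
    apply/setP => i; rewrite inE; have [/tJ[] //|iJ] := boolP (i \in J).
    by rewrite tNJ // ltxx; apply/esym/negbTE; apply: contra iJ; apply/fintype.subsetP.
  have cut_t i : cut u t i = c i.
    have [/tJ[] //|iJ] := boolP (i \in J).
    by rewrite cJ // /cut tNJ // ltxx.
  have : parity t = parity s by rewrite !parT.
  rewrite !(parity_cut u) left_t.
  under eq_bigr => i _ do rewrite cut_t.
  exact: addbI.
have leftJ : left_of u s \subset J.
  by apply/fintype.subsetP => i; rewrite !inE => /lt_eqF ->.
have left_nfree : ~~ has_free (left_of u s).
  have [Tt tx] := selE _ (ux _ leftJ).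
  (* This point lies in [cube s]. No direction of [J] is free there: [c i] is either the excluded
     right end of [s] or its left end, which exceeds [p i]. *)
  have -> : has_free (left_of u s) = [exists i, free s i].
    rewrite /has_free (cube_unique disjT Tt Ts tx) // cubeE => i.
    rewrite mxE inE /c /cut; have := us i; have := p_ge i.
    case: (ltP (s _ i) (u _ i)) => [si|]; last lra.
    by have := p_lt i; rewrite /c /cut !inE si lt_eqF // => /(_ isT); lra.
  apply/existsPn => i; apply/negP => /and3P[iJ]; have := p_lt _ iJ.
  by rewrite /c /cut; case: (ltP (s _ i) (u _ i)); lra.
(* What remains is a sum of equal signs, so its vanishing would make the index set empty, yet it
   contains [left_of u s]. *)
move: total; rewrite (bigID has_free) /= freesum add0r.
rewrite (eq_bigr (fun=> (-1) ^+ #|left_of u s|)); last first.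
  by move=> A /andP[AJ nfree]; rewrite -signr_odd (pinned _ AJ nfree) signr_odd.
rewrite sumr_const => /eqP; rewrite mulrn_eq0 signr_eq0 orbF => /eqP/card0_eq.
by move=> /(_ (left_of u s)); rewrite -topredE /= leftJ left_nfree.
Qed.

Theorem theorem3 (R : realType) (d : nat) (hd : (1 <= d)%N)
    (S : set 'rV[R]_d) (hS : S !=set0)
    (hdisj : trivIset S (@cube R d)) :
  exists S0 S1 : set 'rV[R]_d,
    [/\ S = S0 `|` S1, S0 `&` S1 = set0, rough S0 & rough S1].
Proof.
exists (S `&` [set s | parity s]), (S `&` [set s | ~~ parity s]); split.
- apply/seteqP; split=> [s Ss|s [[]|[]]//].
  by case: (boolP (parity s)) => ?; [left|right].
- by apply/seteqP; split=> // s [[_ /= ->] []].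
- apply: (@monochromatic_rough _ _ _ true) => [|s []//].
  by apply: sub_trivIset hdisj => s [].
- apply: (@monochromatic_rough _ _ _ false) => [|s [_ /negPf]//].
  by apply: sub_trivIset hdisj => s [].
Qed.
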